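(* Let $I\subset R=\mathbb{K}[x_1,\ldots,x_n]$ be a monomial ideal generated by monomials $f_1,\ldots,f_m$, and let $d_i=\deg(f_i)$ for $i=1,\ldots,m$. Suppose that for each $k=2,\ldots,m$ the colon ideal $(f_1,\ldots,f_{k-1}):f_k$ is generated by an $(a_k,r_k)$-regular sequence. Set $a_1=r_1=0$, and for $i,j\ge 0$ let $K^i_j=\{1\le k\le m: a_ki+d_k=j\}$. Suppose moreover that one of the following conditions is satisfied: (1) $a_2=\cdots=a_m=a$ and $d_\ell-d_k\ne a$ for all $k\ge 2$ and $1\le \ell\le k-1$; (2) $a_1\le a_2\le\cdots\le a_m$ and $d_1\le d_2\le\cdots\le d_m$. Then for all $i,j\ge 0$, $$\beta_{i,j}(I)=\sum_{k\in K^i_j}\binom{r_k}{i}.$$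
   Context: $\mathbb{K}$ is a field and $R=\mathbb{K}[x_1,\ldots,x_n]$ is the standard graded polynomial ring; $\beta_{i,j}(M)=\dim_{\mathbb{K}}\mathrm{Tor}_i^R(M,\mathbb{K})_j$. An $(a,r)$-regular sequence is a regular sequence $u_1,\ldots,u_r$ of monomials in $R$ with $\deg(u_1)=\cdots=\deg(u_r)=a$; a sequence of (non-constant) monomials is regular if and only if the monomials have pairwise disjoint supports. Binomial coefficients $\binom{r}{i}$ are $0$ for $i>r$, $\binom{0}{0}=1$, and an empty sum is $0$. *)

(* Defs.v *)
From HB Require Import structures.
From mathcomp Require Import all_boot all_order all_algebra.
From mathcomp Require Import mpoly.
From Stdlib Require Import ClassicalEpsilon.

Set Implicit Arguments.
Unset Strict Implicit.
Unset Printing Implicit Defensive.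

Import GRing.Theory.
Local Open Scope ring_scope.

Definition ideal_gen (K : fieldType) (n m : nat) (P : pred 'I_m)
    (g : 'I_m -> {mpoly K[n]}) (p : {mpoly K[n]}) : Prop :=
  exists c : 'I_m -> {mpoly K[n]}, p = \sum_(l < m | P l) c l * g l.

Definition mon_ideal (K : fieldType) (n m : nat) (P : pred 'I_m)
    (f : 'I_m -> 'X_{1..n}) : {mpoly K[n]} -> Prop :=
  ideal_gen P (fun l => 'X_[K, f l]).

Definition colon (K : fieldType) (n : nat) (I : {mpoly K[n]} -> Prop)
    (g p : {mpoly K[n]}) : Prop := I (p * g).

Definition regular_seq (K : fieldType) (n r : nat)
    (g : 'I_r -> {mpoly K[n]}) : Prop :=
  (forall (k : 'I_r) (p : {mpoly K[n]}),
      ideal_gen [pred l : 'I_r | (l < k)%N] g (p * g k) ->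
      ideal_gen [pred l : 'I_r | (l < k)%N] g p)
  /\ ~ ideal_gen predT g 1.

Definition ar_regular (K : fieldType) (n a r : nat)
    (u : 'I_r -> 'X_{1..n}) : Prop :=
  regular_seq (fun l => 'X_[K, u l]) /\ forall l, mdeg (u l) = a.

(* The data of a complex of graded free modules of finite rank with an
   augmentation F_0 -> R, where F_i = \bigoplus_k R(- shift i k).  Elements of
   F_i are row vectors, so that row k of [diff i] is the image in F_i of the
   k-th basis element of F_(i+1). *)
Record gr_free_complex (K : fieldType) (n : nat) := GrFreeComplex {
  rk : nat -> nat;
  shift : forall i, 'I_(rk i) -> nat;
  diff : forall i, 'M[{mpoly K[n]}]_(rk i.+1, rk i);
  aug : 'cV[{mpoly K[n]}]_(rk 0)
}.

Definition zero_complex (K : fieldType) (n : nat) : gr_free_complex K n :=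
  @GrFreeComplex K n (fun=> 0%N) (fun _ _ => 0%N) (fun=> 0) 0.

(* The maps of the complex preserve degrees; entries vanish when the required
   degree would be negative. *)
Definition homogeneous_complex (K : fieldType) (n : nat)
    (F : gr_free_complex K n) : Prop :=
  (forall (k : 'I_(rk F 0)) (t : 'X_{1..n}),
      t \in msupp (aug F k 0) -> mdeg t = shift k)
  /\ (forall i (k : 'I_(rk F i.+1)) (l : 'I_(rk F i)) (t : 'X_{1..n}),
      t \in msupp (diff F i k l) -> (mdeg t + shift l)%N = shift k).

(* ... -> F_1 -> F_0 -> I -> 0 is exact, with maps of degree 0. *)
Definition gr_free_resolution (K : fieldType) (n : nat)
    (I : {mpoly K[n]} -> Prop) (F : gr_free_complex K n) : Prop :=
  [/\ homogeneous_complex F,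
      forall p, I p <-> exists v : 'rV_(rk F 0), p = (v *m aug F) 0 0,
      forall v : 'rV_(rk F 0),
        v *m aug F = 0 <-> exists w : 'rV_(rk F 1), v = w *m diff F 0
    & forall i (v : 'rV_(rk F i.+1)),
        v *m diff F i = 0 <->
        exists w : 'rV_(rk F i.+2), v = w *m diff F i.+1].

(* F_i (x)_R K = K^(rk i), with differentials reduced modulo (x_1, ..., x_n),
   i.e. entrywise replaced by their constant coefficients. *)
Definition diffK (K : fieldType) (n : nat) (F : gr_free_complex K n) (i : nat) :
    'M[K]_(rk F i.+1, rk F i) :=
  map_mx (fun p : {mpoly K[n]} => p@_0%MM) (diff F i).

(* Subspaces of K^(rk i) are row spaces of matrices; this one is the degree j
   component of F_i (x)_R K, spanned by the basis elements of degree j. *)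
Definition gr_piece (K : fieldType) (n : nat) (F : gr_free_complex K n)
    (i j : nat) : 'M[K]_(rk F i) :=
  diag_mx (\row_(k < rk F i) (shift k == j)%:R).

Definition cycles (K : fieldType) (n : nat) (F : gr_free_complex K n)
    (i j : nat) : 'M[K]_(rk F i) :=
  match i return 'M[K]_(rk F i) with
  | 0 => gr_piece F 0 j
  | i'.+1 => (gr_piece F i'.+1 j :&: kermx (diffK F i'))%MS
  end.

Definition boundaries (K : fieldType) (n : nat) (F : gr_free_complex K n)
    (i j : nat) : 'M[K]_(rk F i.+1, rk F i) :=
  gr_piece F i.+1 j *m diffK F i.

(* dim_K H_i(F (x)_R K)_j; boundaries are cycles when F is a resolution, so the
   truncated subtraction is the dimension of the quotient. *)
Definition homology_dim (K : fieldType) (n : nat) (F : gr_free_complex K n)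
    (i j : nat) : nat :=
  (\rank (cycles F i j) - \rank (boundaries F i j))%N.

Definition resolution_of (K : fieldType) (n : nat)
    (I : {mpoly K[n]} -> Prop) : gr_free_complex K n :=
  epsilon (inhabits (zero_complex K n)) (gr_free_resolution I).

(* dim_K Tor_i^R(I, K)_j for a homogeneous ideal I, with Tor computed from a
   chosen graded free resolution of I (one of finite rank in each homological
   degree exists by Hilbert's basis theorem). *)
Definition betti (K : fieldType) (n : nat) (I : {mpoly K[n]} -> Prop)
    (i j : nat) : nat :=
  homology_dim (resolution_of I) i j.

(* Main.v *)
Require Import Defs.
From HB Require Import structures.
From mathcomp Require Import all_boot all_order all_algebra.
From mathcomp Require Import mpoly zify.
From Stdlib Require Import ClassicalEpsilon.

(** Write [I_k] for the ideal of the first [k] generators.  Multiplication by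
    [f_k] gives an exact sequence
      0 -> R/(I_(k-1) : f_k)(-d_k) -> R/I_(k-1) -> R/I_k -> 0,
    so the mapping cone of a lift of this multiplication to free resolutions is
    a free resolution of [R/I_k] (lemma [cone_resolves]).  The resolution on the
    left comes from the same construction: along a regular sequence the colon
    ideal is the previous ideal itself, and the successive cones build the
    Koszul complex, which has ['C(r, i)] generators, all of degree [a * i], in
    homological degree [i] (lemma [regular_resolution]).  The [k]-th cone thus
    contributes to the [i]-th module of the resolution of the ideal exactly
    ['C(r_k, i)] generators of degree [a_k * i + d_k], which gives the formula
    as soon as the final complex is minimal (lemma [iterated_cone]).

    A cone of minimal complexes is minimal unless the lifted map has a unit
    among its entries.  The map preserves degrees, so a unit forces
      a_k * (i + 1) + d_k = a_l * i + d_l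
    for some [l < k] such that the two Koszul modules are nonzero.  If all
    [a_k] with [k > 1] equal [a], this says that [d_l - d_k = a]; if [a_k] and
    [d_k] are nondecreasing in [k], the left side is larger, because [a_k > 0]
    when [r_k > 0].

    The Betti numbers are read off an unspecified resolution, so they have to be
    compared with those of the cone.  Two resolutions of an ideal are homotopy
    equivalent through maps of degree 0 ([chain_mapP] and [homotopyP]), hence
    each graded piece of the homology of one embeds into that of the other
    ([homology_dim_le]); by symmetry the dimensions agree. *)

Set Implicit Arguments.
Unset Strict Implicit.
Unset Printing Implicit Defensive.

Import GRing.Theory.
Local Open Scope ring_scope.

(** * Matrices of graded maps between free modules *)

Section Homogeneous.

Variables (K : fieldType) (n : nat).
Notation P := {mpoly K[n]}.

Definition mfilter (S : pred 'X_{1..n}) (p : P) : P :=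
  \sum_(t <- msupp p | S t) p@_t *: 'X_[t].

Lemma mcoeff_mfilter S p t : (mfilter S p)@_t = if S t then p@_t else 0.
Proof.
rewrite raddf_sum [in RHS](mpolyE p) raddf_sum /=; case: ifP => St.
  rewrite big_mkcond; apply: eq_bigr => u _; rewrite !mcoeffZ mcoeffX.
  by case: eqP => [->|_]; rewrite ?St // mulr0 if_same.
rewrite big1 // => u Su; rewrite mcoeffZ mcoeffX.
by case: eqP => [e|]; rewrite ?mulr0 //; move: Su; rewrite e St.
Qed.

(** When all monomials of [q] translate [T] into [S], as happens if [q] is
    homogeneous and [S], [T] select degrees, the terms of [p * q] in [S] come
    from the terms of [p] in [T]. *)
Lemma mfilterM (S T : pred 'X_{1..n}) (p q : P) :
    (forall t u, u \in msupp q -> S (t + u)%MM = T t) ->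
  mfilter S (p * q) = mfilter T p * q.
Proof.
move=> hST; have hp : p = mfilter T p + mfilter (predC T) p.
  apply/mpolyP => t; rewrite mcoeffD !mcoeff_mfilter /=.
  by case: (T t); rewrite ?addr0 ?add0r.
have supp U t : t \in msupp (mfilter U p * q) -> exists2 u, U u & S t = T u.
  move=> /msuppM_le/allpairsP [[u v] /= [hu hv ->]].
  exists u; last exact: hST.
  by move: hu; rewrite mcoeff_msupp mcoeff_mfilter; case: (U u); rewrite ?eqxx.
apply/mpolyP => t; rewrite mcoeff_mfilter; case: ifPn => St.
  rewrite {1}hp mulrDl mcoeffD [X in _ + X]memN_msupp_eq0 ?addr0 //.
  by apply/negP => /supp[u /= /negPf nTu]; rewrite St nTu.
by rewrite memN_msupp_eq0 //; apply/negP => /supp[u Tu]; rewrite Tu (negPf St).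
Qed.

(** The degrees [e] and [s] grade the free modules of rows and of columns, so
    this says that [A] is the matrix of a map of degree 0 between them. *)
Definition homog_mx p q (e : 'I_p -> nat) (s : 'I_q -> nat)
    (A : 'M[P]_(p, q)) :=
  forall k l t, t \in msupp (A k l) -> (mdeg t + s l)%N = e k.

Lemma homog_mx0 p q e s : @homog_mx p q e s 0.
Proof. by move=> k l t; rewrite mxE msupp0. Qed.

Lemma homog_mx1 p (e : 'I_p -> nat) : homog_mx e e 1%:M.
Proof.
move=> k l t; rewrite !mxE; case: eqP => [->|_]; last by rewrite msupp0.
by rewrite msupp1 inE => /eqP->; rewrite mdeg0.
Qed.

Lemma homog_mxN p q e s (A : 'M[P]_(p, q)) :
  homog_mx e s A -> homog_mx e s (- A).
Proof. by move=> hA k l t; rewrite mxE (perm_mem (msuppN _)); apply: hA. Qed.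

Lemma homog_mxD p q e s (A B : 'M[P]_(p, q)) :
  homog_mx e s A -> homog_mx e s B -> homog_mx e s (A + B).
Proof.
move=> hA hB k l t; rewrite mxE => /msuppD_le; rewrite mem_cat.
by case/orP => [/hA|/hB].
Qed.

Lemma homog_mxM p q r e s u (A : 'M[P]_(p, q)) (B : 'M[P]_(q, r)) :
  homog_mx e s A -> homog_mx s u B -> homog_mx e u (A *m B).
Proof.
move=> hA hB k l t; rewrite mxE => /msupp_sum_le/flattenP[_ /mapP[i _ ->]].
move=> /msuppM_le/allpairsP [[v w] /= [hv hw ->]].
by rewrite mdegD -addnA (hB _ _ _ hw) (hA _ _ _ hv).
Qed.

Lemma homog_mx_shift d p q e s (A : 'M[P]_(p, q)) :
  homog_mx e s A -> homog_mx (fun k => e k + d)%N (fun l => s l + d)%N A.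
Proof. by move=> hA k l t /hA <-; rewrite addnA. Qed.

(** Taking homogeneous components of the entries of a solution of a homogeneous
    linear system gives a homogeneous solution. *)
Lemma homog_solution p q r e s u (A : 'M[P]_(p, r)) (D : 'M[P]_(q, r))
    (W : 'M[P]_(p, q)) :
    homog_mx e u A -> homog_mx s u D -> A = W *m D ->
  exists2 W', homog_mx e s W' & A = W' *m D.
Proof.
move=> hA hD eqA.
pose deg k c (t : 'X_{1..n}) := (mdeg t + c == e k)%N.
exists (\matrix_(k, l) mfilter (deg k (s l)) (W k l)) => [k l t|].
  rewrite mxE mcoeff_msupp mcoeff_mfilter.
  by case: ifP => [/eqP|]; rewrite ?eqxx.
apply/matrixP => k j; rewrite mxE.
have -> : A k j = mfilter (deg k (u j)) (A k j).
  apply/mpolyP => t; rewrite mcoeff_mfilter; case: ifPn => // /negP nt.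
  by apply/memN_msupp_eq0/negP => /hA /eqP.
have mfilter_sum I (rs : seq I) (F : I -> P) S :
    mfilter S (\sum_(i <- rs) F i) = \sum_(i <- rs) mfilter S (F i).
  apply/mpolyP => t; rewrite mcoeff_mfilter !raddf_sum /=.
  rewrite (eq_bigr _ (fun i _ => mcoeff_mfilter S (F i) t)).
  by case: (S t); rewrite ?big1_eq.
rewrite eqA mxE mfilter_sum; apply: eq_bigr => l _; rewrite mxE.
by apply: mfilterM => t v /hD hv; rewrite /deg mdegD -addnA hv.
Qed.

End Homogeneous.

(** * Resolutions, comparison maps and homotopies *)

Section Complexes.

Variables (K : fieldType) (n : nat).
Implicit Types (F G Q : gr_free_complex K n) (I J : {mpoly K[n]} -> Prop).

(** A resolution of an ideal [I] by [F] is treated as a single exact sequence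
    ending with the rank one module [R] in degree 0, that is, as a resolution
    of [R / I]; the augmentation becomes the differential at index 0. *)
Definition arank F i := if i is i'.+1 then rk F i' else 1%N.

Definition ashift F i : 'I_(arank F i) -> nat :=
  match i with 0 => fun=> 0%N | i'.+1 => @shift _ _ F i' end.

Definition adiff F i : 'M[{mpoly K[n]}]_(arank F i.+1, arank F i) :=
  match i with 0 => aug F | i'.+1 => diff F i' end.

Definition homog_complex F :=
  forall i, homog_mx (@ashift F i.+1) (@ashift F i) (adiff F i).

Definition exact F :=
  forall i (v : 'rV_(arank F i.+1)),
    v *m adiff F i = 0 <-> exists w, v = w *m adiff F i.+1.

Definition image_is I F :=
  forall p, I p <-> exists v : 'rV_(arank F 1), p = (v *m adiff F 0) 0 0.

Definition resolves I F := [/\ homog_complex F, image_is I F & exact F].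

Lemma resolvesP I F : gr_free_resolution I F <-> resolves I F.
Proof.
split=> [[[h0 h1] hI e0 e1]|[h hI e]]; split=> //.
- case=> [|i] k l t; last exact: h1.
  by rewrite /= addn0 [l]ord1; apply: h0.
- by move=> [|i]; [apply: e0 | apply: e1].
- split=> [k t ht|i]; last exact: (h i.+1).
  by have := h 0%N k 0 t ht; rewrite /= addn0.
- exact: (e 0%N).
- by move=> i; apply: (e i.+1).
Qed.

Lemma adiffM0 F i : exact F -> adiff F i.+1 *m adiff F i = 0.
Proof.
move=> hF; apply/row_matrixP => k; rewrite row0 row_mul.
by apply/hF; exists (delta_mx 0 k); rewrite rowE.
Qed.

(** Solving by choice makes comparison maps and homotopies, which are built by
    successive lifts, plain recursive functions; that every lift exists is then
    proved by a separate induction. *)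
Definition hlift p q r (e : 'I_p -> nat) (s : 'I_q -> nat)
    (A : 'M[{mpoly K[n]}]_(p, r)) (D : 'M_(q, r)) : 'M_(p, q) :=
  epsilon (inhabits 0) (fun W => homog_mx e s W /\ A = W *m D).

Lemma hliftP p q r e s u (A : 'M[{mpoly K[n]}]_(p, r)) (D : 'M_(q, r)) :
    homog_mx e u A -> homog_mx s u D ->
    (forall k, exists w : 'rV_q, row k A = w *m D) ->
  homog_mx e s (hlift e s A D) /\ A = hlift e s A D *m D.
Proof.
move=> hA hD hw.
pose w k := proj1_sig (constructive_indefinite_description _ (hw k)).
have eqA : A = (\matrix_k w k) *m D.
  apply/row_matrixP => k; rewrite row_mul rowK /w.
  by case: constructive_indefinite_description.
have [W hW eW] := homog_solution hA hD eqA.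
have ex : exists W, homog_mx e s W /\ A = W *m D by exists W.
exact: (epsilon_spec (inhabits 0) _ ex).
Qed.

Lemma hlift_exact p F i e (A : 'M[{mpoly K[n]}]_(p, arank F i.+1)) :
    homog_complex F -> exact F ->
    homog_mx e (@ashift F i.+1) A -> A *m adiff F i = 0 ->
  let W := hlift e (@ashift F i.+2) A (adiff F i.+1) in
  homog_mx e (@ashift F i.+2) W /\ A = W *m adiff F i.+1.
Proof.
move=> hF eF hA A0; apply: hliftP hA (hF i.+1) _ => k.
by apply/eF; rewrite -row_mul A0 row0.
Qed.

(** The lift of multiplication by [g] to a map of complexes. *)
Fixpoint chain_map Q F (g : {mpoly K[n]}) d i :
    'M[{mpoly K[n]}]_(arank Q i, arank F i) :=
  if i is i'.+1 then
    hlift (fun k => @ashift Q i'.+1 k + d)%N (@ashift F i'.+1)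
      (adiff Q i' *m chain_map Q F g d i') (adiff F i')
  else g%:M.

(** Each lift exists: the image of [adiff Q i *m chain_map i] is killed by the
    next differential of the exact sequence [F], and for [i = 0] it consists of
    elements [p * g] with [p] in [J]. *)
Lemma chain_mapP I J Q F g d :
    (forall t, t \in msupp g -> mdeg t = d) ->
    (forall p, J p -> I (p * g)) -> resolves J Q -> resolves I F ->
  (forall i, homog_mx (fun k => @ashift Q i k + d)%N (@ashift F i)
               (chain_map Q F g d i))
  /\ (forall i, adiff Q i *m chain_map Q F g d i
                = chain_map Q F g d i.+1 *m adiff F i).
Proof.
move=> hg hJ [hQ iQ eQ] [hF iF eF].
have step i : homog_mx (fun k => @ashift Q i k + d)%N (@ashift F i)
                (chain_map Q F g d i)
    /\ (forall w : 'rV_(arank Q i.+1),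
          exists v, w *m (adiff Q i *m chain_map Q F g d i) = v *m adiff F i) ->
    homog_mx (fun k => @ashift Q i.+1 k + d)%N (@ashift F i.+1)
      (chain_map Q F g d i.+1)
    /\ adiff Q i *m chain_map Q F g d i = chain_map Q F g d i.+1 *m adiff F i.
  case=> hc hv; apply: (@hliftP _ _ _ _ _ (@ashift F i)) => // [|k].
    apply: homog_mxM hc; exact: homog_mx_shift.
  by rewrite rowE; apply: hv.
have all i : homog_mx (fun k => @ashift Q i k + d)%N (@ashift F i)
                (chain_map Q F g d i)
    /\ (forall w : 'rV_(arank Q i.+1),
          exists v, w *m (adiff Q i *m chain_map Q F g d i) = v *m adiff F i).
  elim: i => [|i /step[h1 e1]].
    split=> [k l t|w].
      by rewrite mxE [k]ord1 [l]ord1 eqxx addn0 => /hg.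
    have /hJ/iF[v hv] : J ((w *m adiff Q 0) 0 0) by apply/iQ; exists w.
    exists v; apply/matrixP => k l; rewrite [k]ord1 [l]ord1 -hv.
    by rewrite mulmxA mul_mx_scalar mxE mulrC.
  split=> // w.
  apply/eF; rewrite -!mulmxA -e1 (mulmxA (adiff Q _)) adiffM0 // mul0mx.
  by rewrite mulmx0.
by split=> i; have [] := step i (all i); have [] := all i.
Qed.

(** A homotopy from [f] to [0], meaningful for a chain endomorphism [f] that
    vanishes on the rank one module in degree 0. *)
Fixpoint homotopy F (f : forall i, 'M[{mpoly K[n]}]_(arank F i)) i :
    'M[{mpoly K[n]}]_(arank F i, arank F i.+1) :=
  if i is i'.+1 then
    hlift (@ashift F i'.+1) (@ashift F i'.+2)
      (f i'.+1 - adiff F i' *m homotopy f i') (adiff F i'.+1)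
  else 0.

(** The defect [f i - homotopy i *m adiff i] is killed by composition with
    [adiff i], and this is what makes the next lift possible. *)
Lemma homotopyP F (f : forall i, 'M[{mpoly K[n]}]_(arank F i)) :
    homog_complex F -> exact F ->
    (forall i, homog_mx (@ashift F i) (@ashift F i) (f i)) ->
    (forall i, adiff F i *m f i = f i.+1 *m adiff F i) -> f 0%N = 0 ->
  forall i, homog_mx (@ashift F i) (@ashift F i.+1) (homotopy f i)
    /\ f i.+1 = homotopy f i.+1 *m adiff F i.+1 + adiff F i *m homotopy f i.
Proof.
move=> hF eF hf cf f0.
have step i : homog_mx (@ashift F i) (@ashift F i.+1) (homotopy f i) ->
    adiff F i *m (f i - homotopy f i *m adiff F i) = 0 ->
    homog_mx (@ashift F i.+1) (@ashift F i.+2) (homotopy f i.+1)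
    /\ f i.+1 - adiff F i *m homotopy f i = homotopy f i.+1 *m adiff F i.+1.
  move=> hh e; apply: hlift_exact => //.
    by apply/homog_mxD/homog_mxN/(homog_mxM (hF i) hh).
  by rewrite mulmxBl -cf -mulmxA -mulmxBr.
have all i : homog_mx (@ashift F i) (@ashift F i.+1) (homotopy f i)
    /\ adiff F i *m (f i - homotopy f i *m adiff F i) = 0.
  elim: i => [|i [h e]].
    by split; [apply: homog_mx0 | rewrite f0 mul0mx subr0 mulmx0].
  have [h' e'] := step i h e; split=> //.
  by rewrite -e' opprB addrCA subrr addr0 mulmxA adiffM0 // mul0mx.
move=> i; have [h e] := all i; split=> //.
by have [_ <-] := step i h e; rewrite subrK.
Qed.

End Complexes.

(** * Betti numbers do not depend on the resolution *)

Section BettiNumbers.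

Variables (K : fieldType) (n : nat).
Implicit Types (F G Q : gr_free_complex K n) (I J : {mpoly K[n]} -> Prop).
Notation P := {mpoly K[n]}.

(** Reduction modulo the variables. *)
Definition redK p q (A : 'M[P]_(p, q)) : 'M[K]_(p, q) :=
  map_mx (mcoeff 0%MM : P -> K) A.

Definition piece p (e : 'I_p -> nat) j : 'M[K]_p :=
  diag_mx (\row_k (e k == j)%:R).

Lemma pieceP p (e : 'I_p -> nat) j (v : 'rV_p) :
  (v <= piece e j)%MS <-> forall k, e k != j -> v 0 k = 0.
Proof.
split=> [/submxP[w ->] k /negPf kj|hv].
  by rewrite mul_mx_diag !mxE kj mulr0.
apply/submxP; exists v; apply/rowP => k; rewrite mul_mx_diag !mxE.
by case: eqP => [_|/eqP /hv ->]; rewrite ?mulr1 ?mul0r.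
Qed.

Lemma rank_piece p (e : 'I_p -> nat) j :
  \rank (piece e j) = (\sum_(k < p) (e k == j))%N.
Proof.
pose S := [pred k : 'I_p | e k == j].
(* the nonzero rows of the diagonal matrix, which are orthonormal *)
pose E : 'M[K]_(#|S|, p) := \matrix_(i, k) (enum_val i == k)%:R.
have ES : E *m piece e j = E.
  apply/matrixP => i k; rewrite mul_mx_diag !mxE.
  case: eqP => [<-|_]; last by rewrite mul0r.
  by have := enum_valP i; rewrite inE => ->; rewrite mulr1.
have ET : E *m E^T = 1%:M.
  apply/matrixP => i k; rewrite !mxE (bigD1 (enum_val i)) //= !mxE eqxx mul1r.
  rewrite big1 ?addr0 ?(inj_eq enum_val_inj) 1?eq_sym // => l.
  by rewrite !mxE eq_sym => /negPf->; rewrite mul0r.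
have SE : (piece e j <= E)%MS.
  apply/rV_subP => v /pieceP hv; apply/submxP; exists (v *m E^T).
  apply/rowP => k; rewrite -mulmxA mxE.
  rewrite (bigD1 k) //= big1 ?addr0 => [|l lk].
    have [kS|/hv->] := boolP (e k == j); last by rewrite mul0r.
    rewrite mxE (bigD1 (enum_rank_in kS k)) //= !mxE enum_rankK_in // eqxx.
    rewrite mul1r.
    rewrite big1 ?addr0 ?mulr1 // => i ik; rewrite !mxE.
    case: eqP => [ek|_]; last by rewrite mul0r.
    by rewrite -(inj_eq enum_val_inj) enum_rankK_in // ek eqxx in ik.
  rewrite mxE big1 ?mulr0 // => i _; rewrite !mxE.
  by case: eqP => [->|]; rewrite ?(negPf lk) ?mulr0 ?mul0r.
have rE : \rank E = #|S| by apply/eqP/row_freeP; exists E^T.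
have -> : (\sum_k (e k == j) = #|S|)%N.
  rewrite -sum1_card [RHS]big_mkcond; apply: eq_bigr => k _.
  by rewrite inE; case: eqP.
apply/eqP; rewrite eqn_leq -{1}rE mxrankS //= -rE -{1}ES.
exact: mxrankM_maxr.
Qed.

Lemma piece_map p q (e : 'I_p -> nat) (s : 'I_q -> nat) A j (v : 'rV_p) :
  homog_mx e s A -> (v <= piece e j -> v *m redK A <= piece s j)%MS.
Proof.
move=> hA /pieceP hv; apply/pieceP => l lj; rewrite mxE big1 // => k _.
have [ekj|/hv->] := eqVneq (e k) j; last by rewrite mul0r.
rewrite mxE memN_msupp_eq0 ?mulr0 //; apply/negP => /hA.
by rewrite mdeg0 add0n ekj; apply/eqP.
Qed.

Lemma boundariesP F i j (v : 'rV_(rk F i)) :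
  (v <= boundaries F i j)%MS <->
  exists2 w : 'rV_(rk F i.+1), (w <= piece (@shift _ _ F i.+1) j)%MS
    & v = w *m redK (diff F i).
Proof.
split=> [/submxP[w ->]|[w hw ->]]; last exact: submxMr.
by exists (w *m piece (@shift _ _ F i.+1) j); rewrite ?submxMl // -mulmxA.
Qed.

Lemma cyclesP F i j (v : 'rV_(rk F i)) :
  (v <= cycles F i j)%MS <-> (v <= piece (@shift _ _ F i) j)%MS /\
    (match i return 'rV[K]_(rk F i) -> Prop with
     | 0 => fun=> True
     | i'.+1 => fun u => u *m redK (diff F i') = 0
     end v).
Proof.
case: i v => [|i] v /=; first by split=> // -[].
rewrite sub_capmx (sameP sub_kermxP eqP).
by split=> [/andP[-> /eqP]|[-> ->]] //; rewrite eqxx.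
Qed.

Lemma redKM p q r (A : 'M[P]_(p, q)) (B : 'M[P]_(q, r)) :
  redK (A *m B) = redK A *m redK B.
Proof. exact: map_mxM. Qed.

Lemma redK0 p q : redK (0 : 'M[P]_(p, q)) = 0.
Proof. exact: map_mx0. Qed.

Section ChainMap.

Variables (F G : gr_free_complex K n).
Variable phi : forall i, 'M[P]_(arank F i, arank G i).
Hypothesis hphi : forall i,
  homog_mx (@ashift _ _ F i) (@ashift _ _ G i) (phi i).
Hypothesis cphi : forall i, adiff F i *m phi i = phi i.+1 *m adiff G i.

Lemma cycles_map i j (v : 'rV_(rk F i)) :
  (v <= cycles F i j -> v *m redK (phi i.+1) <= cycles G i j)%MS.
Proof.
move=> /cyclesP[hv dv]; apply/cyclesP; split.
  exact: (@piece_map _ _ _ _ _ j v (@hphi i.+1) hv).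
case: i v dv {hv} => [|i] v dv //.
rewrite -mulmxA -redKM -(cphi i.+1) redKM mulmxA.
by rewrite dv mul0mx.
Qed.

Lemma boundaries_map i j (v : 'rV_(rk F i)) :
  (v <= boundaries F i j -> v *m redK (phi i.+1) <= boundaries G i j)%MS.
Proof.
move=> /boundariesP[w hw ->]; apply/boundariesP.
exists (w *m redK (phi i.+2)).
  exact: (@piece_map _ _ _ _ _ j w (@hphi i.+2) hw).
by rewrite -!mulmxA -!redKM -(cphi i.+1).
Qed.

End ChainMap.

Lemma boundaries_cycles F i j : homog_complex F -> exact F ->
  (boundaries F i j <= cycles F i j)%MS.
Proof.
move=> hF eF; apply/rV_subP => v /boundariesP[w hw ->]; apply/cyclesP.
split; first exact: (@piece_map _ _ _ _ _ j w (hF i.+1) hw).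
case: i v w hw => [|i] v w hw //; rewrite -mulmxA -redKM.
by rewrite (adiffM0 i.+1 eF) redK0 mulmx0.
Qed.

(** The hypotheses make [Phi] induce an injective map from [Z / B] to [Z' / B'].
    A complement of [B] in [Z] is then mapped injectively to a subspace of [Z']
    that meets [B'] trivially. *)
Lemma rank_quotient_le p q b c (Z : 'M[K]_p) (B : 'M_(b, p)) (Z' : 'M_q)
    (B' : 'M_(c, q)) (Phi : 'M_(p, q)) :
    (B' <= Z')%MS ->
    (forall v : 'rV_p, (v <= Z -> v *m Phi <= Z')%MS) ->
    (forall v : 'rV_p, (v <= Z -> v *m Phi <= B' -> v <= B)%MS) ->
  (\rank Z - \rank B <= \rank Z' - \rank B')%N.
Proof.
move=> BZ ZZ inj; pose C := (Z :\: B)%MS.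
have CZ : (C <= Z)%MS by exact: diffmxSl.
have CB (v : 'rV_p) : (v <= C)%MS -> (v *m Phi <= B')%MS -> v = 0.
  move=> vC vB; apply/eqP; rewrite -submx0 -(capmx_diff Z B) sub_capmx vC.
  by rewrite (inj v (submx_trans vC CZ) vB).
have rC : \rank (C *m Phi) = \rank C.
  apply/mxrank_injP; rewrite -submx0; apply/rV_subP => v.
  rewrite sub_capmx => /andP[vC /sub_kermxP vP].
  by rewrite (CB v vC) ?sub0mx // vP sub0mx.
have dis : (C *m Phi :&: B')%MS = 0.
  apply/eqP; rewrite -submx0; apply/rV_subP => v.
  rewrite sub_capmx => /andP[/submxP[w ->]]; rewrite mulmxA => wB.
  by rewrite (CB _ (submxMl w C) wB) mul0mx sub0mx.
have : (\rank C + \rank B' <= \rank Z')%N.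
  rewrite -rC -mxrank_disjoint_sum // mxrankS // addsmx_sub BZ andbT.
  apply/rV_subP => v /submxP[w ->]; rewrite mulmxA; apply: ZZ.
  exact: submx_trans (submxMl w C) CZ.
have := mxrank_cap_compl Z B; rewrite -/C.
have := mxrankS (capmxSr Z B); lia.
Qed.

(** The identity of [I] lifts to [phi : F -> G] and [psi : G -> F], and
    [1 - phi *m psi] is homotopic to 0.  A cycle of [F] that [phi] sends to a
    boundary is therefore a boundary: [phi] is injective on homology. *)
Lemma homology_dim_le I F G i j : resolves I F -> resolves I G ->
  (homology_dim F i j <= homology_dim G i j)%N.
Proof.
move=> rF rG; have [hF _ eF] := rF; have [hG _ eG] := rG.
have deg1 t : t \in msupp (1 : P) -> mdeg t = 0%N.
  by rewrite msupp1 inE => /eqP->; rewrite mdeg0.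
have map1 (A B : gr_free_complex K n) : resolves I A -> resolves I B ->
    (forall i, homog_mx (@ashift _ _ A i) (@ashift _ _ B i)
                 (chain_map A B 1 0 i))
    /\ (forall i, adiff A i *m chain_map A B 1 0 i
                  = chain_map A B 1 0 i.+1 *m adiff B i).
  move=> rA rB; have I1 p : I p -> I (p * 1) by rewrite mulr1.
  have [hm cm] := chain_mapP deg1 I1 rA rB; split=> // l k k' t ht.
  by rewrite (hm l k k' t ht) addn0.
have [hphi cphi] := map1 F G rF rG; have [hpsi cpsi] := map1 G F rG rF.
set phi := chain_map F G 1 0 in hphi cphi.
set psi := chain_map G F 1 0 in hpsi cpsi.
pose f l := 1%:M - phi l *m psi l.
have hf l : homog_mx (@ashift _ _ F l) (@ashift _ _ F l) (f l).
  apply/homog_mxD/homog_mxN/(homog_mxM (hphi l) (hpsi l)); exact: homog_mx1.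
have cf l : adiff F l *m f l = f l.+1 *m adiff F l.
  by rewrite mulmxBr mulmxBl mulmx1 mul1mx mulmxA cphi -!mulmxA cpsi.
have f0 : f 0%N = 0 by rewrite /f mulmx1 subrr.
have hom := homotopyP hF eF hf cf f0.
apply: (rank_quotient_le (Phi := redK (phi i.+1))) => [|v|v vZ vB].
- exact: boundaries_cycles.
- exact: cycles_map.
(* the first summand is the image of a boundary, the second one is a boundary
   because the homotopy vanishes on cycles up to boundaries *)
have -> : v = v *m redK (phi i.+1) *m redK (psi i.+1) + v *m redK (f i.+1).
  rewrite -mulmxA -mulmxDr -redKM -[X in _ *m X]map_mxD /f addrC subrK.
  by rewrite [map_mx _ _]map_mx1 mulmx1.
apply: addmx_sub; first exact: boundaries_map vB.
have [vj dv] := (cyclesP j v).1 vZ.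
have [_ ->] := hom i; rewrite [redK _]map_mxD mulmxDr -!/(redK _).
have -> : v *m redK (adiff F i *m homotopy f i) = 0.
  (* for i = 0 there is no differential out of F_0, but homotopy 0 is zero *)
  case: i v {vZ vB vj} dv => [|i] v dv; first by rewrite mulmx0 redK0 mulmx0.
  by rewrite redKM mulmxA dv mul0mx.
rewrite addr0 redKM mulmxA; apply/boundariesP.
exists (v *m redK (homotopy f i.+1)) => //.
have [hi _] := hom i.+1; exact: (@piece_map _ _ _ _ _ j v hi vj).
Qed.

(** The augmentation is left out: a unit in it does not spoil minimality, since
    it only says that the ideal contains 1. *)
Definition minimal F := forall i, redK (diff F i) = 0.

Lemma betti_minimal I F i j : resolves I F -> minimal F ->
  betti I i j = (\sum_(k < rk F i) (shift k == j))%N.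
Proof.
move=> rF mF.
have rI : resolves I (resolution_of I).
  have ex : exists F, gr_free_resolution I F by exists F; apply/resolvesP.
  exact/resolvesP/(epsilon_spec (inhabits (zero_complex K n)) _ ex).
have -> : betti I i j = homology_dim F i j.
  apply/eqP; rewrite eqn_leq.
  by rewrite (homology_dim_le i j rI rF) (homology_dim_le i j rF rI).
rewrite /homology_dim -rank_piece.
have -> : boundaries F i j = 0.
  by rewrite /boundaries -[diffK F i]/(redK (diff F i)) mF mulmx0.
rewrite mxrank0 subn0; case: i => [|i] //=.
rewrite -[diffK F i]/(redK (diff F i)) mF.
apply/eqP; rewrite eqn_leq !mxrankS ?capmxSl // sub_capmx submx_refl /=.
by apply/sub_kermxP; rewrite mulmx0.
Qed.

End BettiNumbers.

(** * Mapping cones and Koszul complexes *)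

Arguments chain_map : simpl never.

Section MappingCone.

Variables (K : fieldType) (n : nat).
Implicit Types (F G Q : gr_free_complex K n) (I J : {mpoly K[n]} -> Prop).
Notation P := {mpoly K[n]}.

Definition degsum p q (e : 'I_p -> nat) (s : 'I_q -> nat) (k : 'I_(p + q)) :=
  match split k with inl k' => e k' | inr k' => s k' end.

Lemma degsuml p q (e : 'I_p -> nat) (s : 'I_q -> nat) k :
  degsum e s (lshift q k) = e k.
Proof. by rewrite /degsum (unsplitK (inl k)). Qed.

Lemma degsumr p q (e : 'I_p -> nat) (s : 'I_q -> nat) k :
  degsum e s (rshift p k) = s k.
Proof. by rewrite /degsum (unsplitK (inr k)). Qed.

Lemma homog_col_mx p q r (e : 'I_p -> nat) (s : 'I_q -> nat) (u : 'I_r -> nat)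
    (A : 'M[P]_(p, r)) (B : 'M[P]_(q, r)) :
  homog_mx e u A -> homog_mx s u B -> homog_mx (degsum e s) u (col_mx A B).
Proof.
move=> hA hB k l t; case: (split_ordP k) => k' ->.
  by rewrite degsuml col_mxEu; apply: hA.
by rewrite degsumr col_mxEd; apply: hB.
Qed.

Lemma homog_row_mx p q r (e : 'I_p -> nat) (s : 'I_q -> nat) (u : 'I_r -> nat)
    (A : 'M[P]_(p, q)) (B : 'M[P]_(p, r)) :
  homog_mx e s A -> homog_mx e u B -> homog_mx e (degsum s u) (row_mx A B).
Proof.
move=> hA hB k l t; case: (split_ordP l) => l' ->.
  by rewrite degsuml row_mxEl; apply: hA.
by rewrite degsumr row_mxEr; apply: hB.
Qed.

(** The mapping cone of multiplication by [g], a map to the resolution [F] of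
    [R / I] from the resolution [Q] of [R / J] with degrees shifted by [d].  The
    rank one module of [Q] becomes the summand of degree 0 that carries the new
    generator [g].  The sign on [adiff Q] makes consecutive maps compose to
    zero. *)
Definition cone F Q (g : P) d : gr_free_complex K n :=
  @GrFreeComplex K n
    (fun i => rk F i + arank Q i)%N
    (fun i => degsum (@shift _ _ F i) (fun k => @ashift _ _ Q i k + d)%N)
    (fun i => block_mx (diff F i) 0 (chain_map Q F g d i.+1) (- adiff Q i))
    (col_mx (aug F) (g%:M : 'M_1)).

Definition add_gen I (g p : P) := exists q c, I q /\ p = q + c * g.

(** If [(v, w)] is a cycle of the cone, then [w] is a cycle of [Q], or in degree
    0 an element of [J], the colon ideal of [I] by [g]; so [w = b *m adiff Q]
    for some [b].  Subtracting the boundary of [(0, - b)] leaves a cycle of [F],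
    which is a boundary too. *)
Lemma cone_resolves I J F Q g d :
    (forall t, t \in msupp g -> mdeg t = d) ->
    (forall p, J p <-> I (p * g)) -> resolves J Q -> resolves I F ->
  resolves (add_gen I g) (cone F Q g d).
Proof.
move=> hg hJ rQ rF; have [hF iF eF] := rF; have [hQ iQ eQ] := rQ.
have [hc cc] := chain_mapP hg (fun p => (hJ p).1) rQ rF.
split=> [i|p|i v].
- case: i => [|i] /=.
    apply: homog_col_mx; first exact: (hF 0%N).
    exact: (hc 0%N).
  rewrite /block_mx; apply: homog_col_mx; apply: homog_row_mx.
  + exact: (hF i.+1).
  + exact: homog_mx0.
  + exact: (hc i.+1).
  + by apply: homog_mxN; apply: homog_mx_shift; exact: hQ.
- split=> [[q [c [/iF[v ->] ->]]]|[v ->]].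
    exists (row_mx v c%:M) => /=.
    rewrite mul_row_col [in RHS]mxE mul_scalar_mx scale_scalar_mx.
    by rewrite [_%:M 0 0]mxE eqxx.
  exists ((lsubmx v *m aug F) 0 0), (rsubmx v 0 0).
  split; first by apply/iF; exists (lsubmx v).
  rewrite -[v in LHS]hsubmxK /= mul_row_col mxE mul_mx_scalar.
  by rewrite [in X in _ + X]mxE mulrC.
case: i v => [|i] v /=.
  rewrite -[v]hsubmxK mul_row_col; split=> [v0|[w]].
    have /hJ/iQ[w hw] : I (rsubmx v 0 0 * g).
      apply/iF; exists (- lsubmx v); rewrite mulNmx [- _](addr0_eq v0).
      by rewrite mul_mx_scalar [in RHS]mxE mulrC.
    have eqw : rsubmx v = w *m adiff Q 0.
      by apply/rowP => k; rewrite [k]ord1 hw.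
    have [w' hw'] : exists w',
        lsubmx v + w *m chain_map Q F g d 1 = w' *m adiff F 1.
      apply/eF; rewrite mulmxDl -mulmxA -(cc 0%N) mulmxA -eqw.
      exact: v0.
    exists (row_mx w' (- w)); rewrite mul_row_block mulmx0 add0r.
    rewrite !mulNmx mulmxN opprK -eqw.
    by rewrite -hw' addrK.
  rewrite -[w]hsubmxK mul_row_block mulmx0 add0r => /eq_row_mx[-> ->].
  rewrite mulmxN mulNmx mulmxDl -!mulmxA.
  have := adiffM0 0 eF => /= ->; rewrite mulmx0 add0r.
  by have /= <- := cc 0%N; rewrite subrr.
rewrite -[v]hsubmxK mul_row_block mulmx0 add0r; split=> [|[w]].
  rewrite -row_mx0 => /eq_row_mx[v0].
  rewrite mulmxN => /eqP; rewrite oppr_eq0 => /eqP /eQ[w hw].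
  have [w' hw'] : exists w',
      lsubmx v + w *m chain_map Q F g d i.+2 = w' *m adiff F i.+2.
    apply/eF; rewrite mulmxDl -mulmxA -(cc i.+1) mulmxA -hw.
    exact: v0.
  exists (row_mx w' (- w)); rewrite mul_row_block mulmx0 add0r.
  rewrite !mulNmx mulmxN opprK.
  by rewrite -[w *m diff Q i]hw -hw' addrK.
rewrite -[w]hsubmxK mul_row_block mulmx0 add0r => /eq_row_mx[-> ->].
rewrite -row_mx0 !mulmxN !mulNmx opprK mulmxDl -!mulmxA; congr row_mx.
  have := adiffM0 i.+1 eF => /= ->; rewrite mulmx0 add0r.
  by have /= <- := cc i.+1; rewrite subrr.
by have := adiffM0 i eQ => /= ->; rewrite mulmx0.
Qed.

(** A unit entry of the comparison map would link basis elements of equal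
    degrees. *)
Lemma cone_minimal I J F Q g d :
    (forall t, t \in msupp g -> mdeg t = d) ->
    (forall p, J p -> I (p * g)) -> resolves J Q -> resolves I F ->
    minimal F -> (forall i, redK (adiff Q i) = 0) ->
    (forall i (k : 'I_(arank Q i.+1)) (l : 'I_(rk F i)),
       ashift k + d != shift l)%N ->
  minimal (cone F Q g d).
Proof.
move=> hg hJ rQ rF mF mQ neq i; have [hc _] := chain_mapP hg hJ rQ rF.
rewrite /redK map_block_mx -!/(redK _) mF redK0 [redK (- _)]map_mxN.
rewrite -/(redK _) mQ oppr0.
suff -> : redK (chain_map Q F g d i.+1) = 0 by rewrite block_mx0.
apply/matrixP => k l; rewrite !mxE memN_msupp_eq0 //.
apply/negP => /(hc i.+1); rewrite mdeg0 add0n => e.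
by case/eqP: (neq i k l); rewrite -e.
Qed.

Lemma sum_degsum p q (e : 'I_p -> nat) (s : 'I_q -> nat) j :
  (\sum_(k < p + q) (degsum e s k == j)
   = \sum_(k < p) (e k == j) + \sum_(k < q) (s k == j))%N.
Proof.
rewrite big_split_ord /=.
by congr (_ + _)%N; apply: eq_bigr => k _; rewrite ?degsuml ?degsumr.
Qed.

Lemma resolves_eq I J F :
  (forall p, I p <-> J p) -> resolves I F -> resolves J F.
Proof.
by move=> IJ [hF iF eF]; split=> // p; split=> [/IJ/iF|/iF/IJ].
Qed.

Lemma zero_resolves : resolves (fun p : P => p = 0) (zero_complex K n).
Proof.
split=> [i|p|i v]; first by case.
  by split=> [->|[v ->]]; [exists 0|]; rewrite mulmx0 mxE.
have -> : v = 0 by apply/rowP => -[].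
by split=> _; [exists 0|]; rewrite mul0mx.
Qed.

Lemma ideal_gen0 m (g : 'I_m -> P) p :
  ideal_gen [pred l : 'I_m | (l < 0)%N] g p <-> p = 0.
Proof.
split=> [[c ->]|->]; first by rewrite big_pred0.
by exists (fun=> 0); rewrite big_pred0.
Qed.

Lemma ideal_genS m (g : 'I_m -> P) (k : 'I_m) p :
  ideal_gen [pred l : 'I_m | (l < k.+1)%N] g p <->
  add_gen (ideal_gen [pred l : 'I_m | (l < k)%N] g) (g k) p.
Proof.
have split_sum (c : 'I_m -> P) : \sum_(l < m | (l < k.+1)%N) c l * g l
    = \sum_(l < m | (l < k)%N) c l * g l + c k * g k.
  rewrite (bigD1 k) //= addrC; congr (_ + _); apply: eq_bigl => l.
  by rewrite ltnS andbC -ltn_neqAle.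
split=> [[c ->]|[_ [b [[c ->] ->]]]].
  by exists (\sum_(l < m | (l < k)%N) c l * g l), (c k); split=> //; exists c.
exists (fun l => if l == k then b else c l); rewrite split_sum eqxx.
congr (_ + _); apply: eq_bigr => l lk.
by case: eqP lk => // ->; rewrite /= ltnn.
Qed.

Lemma ideal_gen_all m (g : 'I_m -> P) p :
  ideal_gen [pred l : 'I_m | (l < m)%N] g p <-> ideal_gen predT g p.
Proof.
have e (c : 'I_m -> P) :
    \sum_(l < m | (l < m)%N) c l * g l = \sum_(l < m) c l * g l.
  by apply: eq_bigl => l; rewrite ltn_ord.
by split=> -[c ->]; exists c; rewrite e.
Qed.

(** In degree 0 the entries would be 1, and the ideal would not be proper. *)
Lemma ar_regular_gt0 a r (u : 'I_r -> 'X_{1..n}) :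
  ar_regular K a u -> (0 < r)%N -> (0 < a)%N.
Proof.
move=> [[_ proper] deg_u] r0; rewrite lt0n; apply/eqP => a0; apply: proper.
exists (fun l => (l == Ordinal r0)%:R).
rewrite (bigD1 (Ordinal r0)) //= mul1r big1; last first.
  by move=> l /negPf->; rewrite mul0r.
have /eqP := deg_u (Ordinal r0); rewrite a0 mdeg_eq0 => /eqP->.
by rewrite mpolyX0 addr0.
Qed.

(** Regularity of the next element [u_s] says that the ideal [J] of the previous
    ones satisfies [J : u_s = J], so the cone of [u_s] on a resolution of
    [R / J] is a resolution; Pascal's rule counts its generators.  For [r > 0]
    the degrees [a * i] and [a * i.+1] of generators in consecutive homological
    degrees differ, hence no differential has a unit entry. *)
Lemma regular_resolution a r (u : 'I_r -> 'X_{1..n}) :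
    ar_regular K a u ->
  exists Q, [/\ resolves (mon_ideal predT u) Q,
    forall i (k : 'I_(arank Q i)), ashift k = (a * i)%N,
    forall i, arank Q i = 'C(r, i) & forall i, redK (adiff Q i) = 0].
Proof.
move=> reg_u; have [[reg _] deg_u] := reg_u.
have main s : (s <= r)%N -> exists Q,
    [/\ resolves (mon_ideal [pred l : 'I_r | (l < s)%N] u) Q,
        forall i (k : 'I_(arank Q i)), ashift k = (a * i)%N
      & forall i, arank Q i = 'C(s, i)].
  elim: s => [_|s IHs sr].
    exists (zero_complex K n); split=> [|[|i] k|[|i]] //; first 1 last.
    - by rewrite muln0.
    - by case: k.
    by apply: resolves_eq zero_resolves => p; apply: iff_sym; apply: ideal_gen0.
  have [Q [rQ dQ nQ]] := IHs (ltnW sr); pose k0 := Ordinal sr.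
  exists (cone Q Q 'X_[K, u k0] a); split=> [|[|i] k|[|i]].
  - apply: resolves_eq (fun p => iff_sym (ideal_genS _ k0 p)) _.
    apply: (cone_resolves _ _ rQ rQ) => [t|p].
      by rewrite msuppX inE => /eqP->.
    split; last exact: reg k0 p.
    move=> [c ->]; exists (fun l => c l * 'X_[K, u k0]).
    by rewrite mulr_suml; apply: eq_bigr => l _; rewrite mulrAC.
  - by rewrite muln0.
  - rewrite /= /degsum; case: (split k) => k'; first exact: (dQ i.+1).
    by rewrite dQ mulnSr.
  - by rewrite bin0.
  - by rewrite /= nQ binS -(nQ i.+1).
have [Q [rQ dQ nQ]] := main r (leqnn r); exists Q; split=> //.
  by apply: resolves_eq rQ => p; apply: ideal_gen_all.
move=> i; apply/matrixP => k l; rewrite !mxE memN_msupp_eq0 //.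
have [hQ _ _] := rQ; apply/negP => /(hQ i); rewrite mdeg0 add0n !dQ mulnS.
have r0 : (0 < r)%N by case: (r) (nQ i.+1) k => // -> [].
have := ar_regular_gt0 reg_u r0; lia.
Qed.

End MappingCone.

(** * Colon ideals generated by regular sequences *)

Section IteratedCone.

Variables (K : fieldType) (n m : nat) (f : 'I_m -> 'X_{1..n}).
Variables (a r : 'I_m -> nat).

(** The second hypothesis keeps generators of the [k]-th Koszul complex in
    homological degree [i.+1] away, in degree, from the generators that an
    earlier complex contributes in homological degree [i]. *)
Lemma iterated_cone :
    (forall k : 'I_m, exists u : 'I_(r k) -> 'X_{1..n},
       ar_regular K (a k) u /\
       forall p : {mpoly K[n]},
         mon_ideal predT u p <->
         mon_ideal [pred l : 'I_m | (l < k)%N] f (p * 'X_[K, f k])) ->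
    (forall (k l : 'I_m) i, (l < k)%N -> (i < r k)%N -> (i <= r l)%N ->
       (a k * i.+1 + mdeg (f k) != a l * i + mdeg (f l))%N) ->
  exists F, [/\ resolves (@mon_ideal K n m predT f) F, minimal F
    & forall i j, (\sum_(k < rk F i) (shift k == j)
        = \sum_(k < m | a k * i + mdeg (f k) == j) 'C(r k, i))%N].
Proof.
move=> hcolon hdeg.
have main s : (s <= m)%N -> exists F,
    [/\ resolves (@mon_ideal K n m [pred l : 'I_m | (l < s)%N] f) F, minimal F
    & forall i j, (\sum_(k < rk F i) (shift k == j)
        = \sum_(k < m | (k < s) && (a k * i + mdeg (f k) == j)) 'C(r k, i))%N].
  elim: s => [_|s IHs sm].
    exists (zero_complex K n); split=> [|i|i j].
    - apply: resolves_eq (zero_resolves K n) => p; apply: iff_sym.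
      exact: ideal_gen0.
    - by apply/matrixP => -[].
    by rewrite big_ord0 big_pred0.
  have [F [rF mF nF]] := IHs (ltnW sm); pose k0 := Ordinal sm.
  have [u [reg_u hu]] := hcolon k0.
  have [Q [rQ dQ nQ mQ]] := regular_resolution reg_u.
  have degX t : t \in msupp 'X_[K, f k0] -> mdeg t = mdeg (f k0).
    by rewrite msuppX inE => /eqP->.
  exists (cone F Q 'X_[K, f k0] (mdeg (f k0))); split=> [||i j].
  - apply: resolves_eq (fun p => iff_sym (ideal_genS _ k0 p)) _.
    exact: cone_resolves rQ rF.
  - apply: (cone_minimal degX (fun p => (hu p).1) rQ rF mF mQ) => i k l.
    (* a free generator of degree [shift l] comes from some earlier [f k1] *)
    have : (0 < \sum_(k < m | (k < s) && (a k * i + mdeg (f k) == shift l))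
              'C(r k, i))%N.
      by rewrite -nF (bigD1 l) //= eqxx.
    rewrite lt0n sum_nat_eq0 => /forallPn[k1]; rewrite negb_imply => /andP[].
    move=> /andP[k1s /eqP <-]; rewrite -lt0n bin_gt0 => ik1.
    rewrite dQ; apply: (hdeg k0) => //.
    by rewrite -bin_gt0 -(nQ i.+1); apply: leq_trans (ltn_ord k).
  rewrite [LHS]sum_degsum nF [RHS](bigID (pred1 k0)) /= addnC; congr (_ + _)%N.
    rewrite (eq_bigr (fun=> nat_of_bool (a k0 * i + mdeg (f k0) == j)%N)).
      rewrite sum_nat_const card_ord nQ.
      rewrite (eq_bigl (fun k => (k == k0) && (a k0 * i + mdeg (f k0) == j)%N)).
        by rewrite big_mkcondr /= big_pred1_eq; case: eqP; rewrite ?muln1 ?muln0.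
      by move=> k; case: (k =P k0) => [->|]; rewrite ?andbF //= ltnSn andbT.
    by move=> k _; rewrite dQ.
  apply: eq_bigl => k; rewrite -[k == k0]/(k == s :> nat) ltnS.
  by rewrite [(k < s)%N]ltn_neqAle [RHS]andbC andbA.
have [F [rF mF nF]] := main m (leqnn m); exists F; split=> //.
  by apply: resolves_eq rF => p; apply: ideal_gen_all.
by move=> i j; rewrite nF; apply: eq_bigl => k; rewrite ltn_ord.
Qed.

End IteratedCone.

Theorem corollary2p10 (K : fieldType) (n m : nat) (f : 'I_m -> 'X_{1..n})
    (a r : 'I_m -> nat)
    (hfirst : forall k : 'I_m, nat_of_ord k = 0%N -> a k = 0%N /\ r k = 0%N)
    (hcolon : forall k : 'I_m, (0 < k)%N ->
       exists u : 'I_(r k) -> 'X_{1..n},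
         ar_regular K (a k) u /\
         forall p : {mpoly K[n]},
           colon (mon_ideal [pred l : 'I_m | (l < k)%N] f) 'X_[K, f k] p <->
           mon_ideal predT u p)
    (hcond :
       (exists a0 : nat,
          (forall k : 'I_m, (0 < k)%N -> a k = a0) /\
          (forall k l : 'I_m, (l < k)%N ->
             (mdeg (f l))%:Z - (mdeg (f k))%:Z <> a0%:Z))
       \/
       ((forall k l : 'I_m, (k <= l)%N -> (a k <= a l)%N) /\
        (forall k l : 'I_m, (k <= l)%N -> (mdeg (f k) <= mdeg (f l))%N))) :
  forall i j : nat,
    betti (@mon_ideal K n m predT f) i j
    = (\sum_(k < m | a k * i + mdeg (f k) == j) 'C(r k, i))%N.
Proof.
have reg k : exists u : 'I_(r k) -> 'X_{1..n}, ar_regular K (a k) u /\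
    forall p : {mpoly K[n]}, mon_ideal predT u p <->
      mon_ideal [pred l : 'I_m | (l < k)%N] f (p * 'X_[K, f k]).
  have [k0|] := posnP k; last first.
    move=> /hcolon[u [reg hu]]; exists u; split=> // p.
    by apply: iff_sym; apply: hu.
  (* for the first generator the colon ideal is zero, as R is a domain *)
  have [ak rk0] := hfirst k k0; rewrite ak rk0.
  exists (fun=> 0%MM); split; first split; first split=> [[]|] //.
  - by move=> [c]; rewrite big_ord0 => /eqP; rewrite oner_eq0.
  - by case.
  move=> p; rewrite k0; apply: iff_trans (iff_sym (ideal_gen0 _ _)).
  split=> [[c]|/eqP]; first by rewrite big_ord0 => ->; rewrite mul0r.
  rewrite mulf_eq0 => /orP[/eqP->|/eqP X0].
    by exists (fun=> 0); rewrite big_ord0.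
  have /eqP := congr1 (mcoeff (f k)) X0.
  by rewrite mcoeffX eqxx mcoeff0 oner_eq0.
have [|F [rF mF nF]] := iterated_cone reg.
  move=> k l i lk ik il; have [u [reg_u _]] := reg k.
  have ak0 : (0 < a k)%N by apply: ar_regular_gt0 reg_u _; apply: leq_trans ik.
  apply/eqP => e; case: hcond => [[a0 [ha hd]]|[ha hd]].
    have := hd k l lk; have -> : a0 = a k by rewrite ha // (leq_trans _ lk).
    (* a l is a0 unless l is the first index, where a l = r l = 0 and i = 0 *)
    have [l0|l_gt0] := posnP l.
      have [al rl] := hfirst l l0; move: il e; rewrite rl leqn0 => /eqP->.
      by rewrite al; lia.
    by move: e; rewrite (ha l) // -(ha k) ?(leq_trans _ lk) //; lia.
  have := ha l k (ltnW lk); have := hd l k (ltnW lk); nia.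
by move=> i j; rewrite (betti_minimal i j rF mF).
Qed.
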